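(* If $r$ is a positive integer, then $$\int_0^\pi \frac{x\sin^3x}{\left(4+5F_{2r}^2\sin^2x\right)^2}\,dx = -\frac{1}{10}\frac{\pi}{F_{4r}^2} + \frac{2\pi\sqrt5}{25}\,\frac{L_{4r}}{F_{4r}^3}\,r\ln\alpha.$$
   Context: $\alpha=(1+\sqrt5)/2$. The Fibonacci numbers are $F_0=0$, $F_1=1$, $F_n=F_{n-1}+F_{n-2}$, and the Lucas numbers are $L_0=2$, $L_1=1$, $L_n=L_{n-1}+L_{n-2}$. *)

(* Defs.v *)
From Stdlib Require Import Reals.
Open Scope R_scope.

Fixpoint fib (n : nat) : nat :=
  match n with
  | 0 => 0
  | S m => match m with 0 => 1 | S k => fib m + fib k end
  end%nat.

Fixpoint lucas (n : nat) : nat :=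
  match n with
  | 0 => 2
  | S m => match m with 0 => 1 | S k => lucas m + lucas k end
  end%nat.

Definition alpha : R := (1 + sqrt 5) / 2.

(* Main.v *)
Require Import Defs.
From Stdlib Require Import Reals.
From Coquelicot Require Import Coquelicot.
From Stdlib Require Import Lra Lia.
Open Scope R_scope.

(** Reflecting [x] to [PI - x] replaces the factor [x] by [PI / 2]; the
    substitution [u = cos x] then leaves the integral of the rational function
    [(1 - u^2) / (p^2 - q^2 u^2)^2] over [[-1, 1]], where [q = sqrt 5 F_{2r}]
    and [p = L_{2r}] satisfy [p^2 = q^2 + 4].  By Binet's formulas
    [p + q] and [p - q] are [2 alpha^(2r)] and [2 / alpha^(2r)], so the
    logarithm in the antiderivative is a multiple of [ln alpha]. *)

(** Continuity of [g] makes the integral [I] exist. Since [sin (PI - x) = sin x], [I] is also the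
    integral of [(PI - x) * g (sin x)], and adding the two gives [I + I = PI * l]. *)
Lemma is_RInt_id_mul_sin (g : R -> R) (l : R) :
  (forall y, continuous g y) ->
  is_RInt (fun x => g (sin x)) 0 PI l ->
  is_RInt (fun x => x * g (sin x)) 0 PI (PI / 2 * l).
Proof.
intros Hg Hl.
assert (Hex : ex_RInt (fun x => x * g (sin x)) 0 PI).
{ apply (ex_RInt_continuous (V := R_CompleteNormedModule)); intros x _.
  apply (continuous_mult (K := R_AbsRing)); [apply continuous_id|].
  apply continuous_comp; [apply continuous_sin | apply Hg]. }
destruct Hex as [I HI].
assert (Href : is_RInt (fun x => (PI - x) * g (sin x)) 0 PI I).
(* The substitution [-1 * x + PI] exchanges the endpoints; the sign of [- I] cancels against the
   factor [-1] it brings out. *)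
{ assert (Hswap : is_RInt (fun x => x * g (sin x)) (-1 * 0 + PI) (-1 * PI + PI) (- I)).
  { replace (-1 * 0 + PI) with PI by ring.
    replace (-1 * PI + PI) with 0 by ring.
    exact (is_RInt_swap _ _ _ _ HI). }
  apply is_RInt_comp_lin, is_RInt_opp in Hswap.
  change (opp (- I)) with (- - I) in Hswap; rewrite Ropp_involutive in Hswap.
  refine (is_RInt_ext _ _ _ _ _ _ Hswap); intros x _.
  unfold opp, scal; simpl; unfold mult; simpl.
  replace (-1 * x + PI) with (PI - x) by ring.
  rewrite sin_PI_x.
  match goal with |- ?a = ?b => change (@eq R a b) end; ring. }
assert (HPI : is_RInt (fun x => PI * g (sin x)) 0 PI (I + I)).
{ refine (is_RInt_ext _ _ _ _ _ _ (is_RInt_plus _ _ _ _ _ _ HI Href)).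
  intros x _; unfold plus; simpl.
  match goal with |- ?a = ?b => change (@eq R a b) end; ring. }
assert (E : I + I = PI * l).
{ rewrite <- (is_RInt_unique _ _ _ _ HPI).
  exact (is_RInt_unique _ _ _ _ (is_RInt_scal _ _ _ PI _ Hl)). }
replace (PI / 2 * l) with I by lra.
exact HI.
Qed.

Lemma is_RInt_sin3_over_square (p q : R) :
  0 < q -> 0 < p -> p ^ 2 = q ^ 2 + 4 ->
  is_RInt (fun x => sin x ^ 3 / (4 + q ^ 2 * sin x ^ 2) ^ 2) 0 PI
    (- (1 / (p * q) ^ 2)
     + (p ^ 2 + q ^ 2) / (2 * (p * q) ^ 3) * (ln (p + q) - ln (p - q))).
Proof.
intros Hq Hp Hpq.
assert (Hlt : q < p) by nra.
(* [G] is a primitive of [(1 - u^2) / (p^2 - q^2 u^2)^2]. The derivatives of its two terms have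
   numerators proportional to [p^2 + q^2 u^2] and [p^2 - q^2 u^2]; the coefficients are those for
   which these combine to [1 - u^2]. *)
set (G := fun u => - ((p ^ 2 - q ^ 2) / (2 * (p * q) ^ 2)) * (u / ((p + q * u) * (p - q * u)))
  + (p ^ 2 + q ^ 2) / (4 * (p * q) ^ 3) * (ln (p + q * u) - ln (p - q * u))).
assert (Hpos : forall x, 0 < p + q * cos x /\ 0 < p - q * cos x).
{ intros x; pose proof (COS_bound x); split; nra. }
replace (- (1 / (p * q) ^ 2)
     + (p ^ 2 + q ^ 2) / (2 * (p * q) ^ 3) * (ln (p + q) - ln (p - q)))
  with (minus (- G (cos PI)) (- G (cos 0))).
2:{ rewrite cos_PI, cos_0; unfold minus, plus, opp, G; simpl.
  replace (p + q * -1) with (p - q) by ring.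
  replace (p - q * -1) with (p + q) by ring.
  rewrite !Rmult_1_r.
  replace ((p + q) * (p - q)) with 4 by lra.
  replace ((p - q) * (p + q)) with 4 by lra.
  replace (p * p - q * q) with 4 by lra.
  field; lra. }
apply (is_RInt_derive (fun x => - G (cos x))).
- intros x _; destruct (Hpos x) as [H1 H2].
  unfold G; auto_derive.
  { repeat split; try lra. apply Rgt_not_eq. nra. }
  (* With [p^2 - q^2 = 4], both sides equal [p^2 - q^2 cos^2 x]. *)
  replace (4 + q ^ 2 * sin x ^ 2) with ((p + q * cos x) * (p - q * cos x)).
  2:{ pose proof (sin2_cos2 x) as E; unfold Rsqr in E.
    replace (sin x ^ 2) with (1 - cos x ^ 2) by lra. lra. }
  replace (sin x ^ 3) with (sin x * (1 - cos x ^ 2)).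
  2:{ pose proof (sin2_cos2 x) as E; unfold Rsqr in E.
    replace (1 - cos x ^ 2) with (sin x ^ 2) by lra. ring. }
  set (u := cos x) in *; set (v := sin x).
  match goal with |- ?a = ?b => change (@eq R a b) end.
  field; repeat split; lra.
- intros x _.
  apply (ex_derive_continuous (K := R_AbsRing) (V := R_NormedModule)).
  auto_derive. assert (0 <= q ^ 2 * sin x ^ 2) by nra. nra.
Qed.

Lemma alpha_sqr : alpha ^ 2 = alpha + 1.
Proof.
unfold alpha; pose proof (sqrt_sqrt 5 ltac:(lra)); nra.
Qed.

Lemma alpha_gt1 : 1 < alpha.
Proof.
unfold alpha; pose proof (sqrt_lt_1 1 5 ltac:(lra) ltac:(lra) ltac:(lra)) as H.
rewrite sqrt_1 in H; lra.
Qed.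

(** [1 - alpha] is the conjugate root of [t^2 = t + 1], so both power sequences obey the recurrence.
    Two consecutive indices are carried because the recurrence reaches back two steps. *)
Lemma fib_lucas_binet (n : nat) :
  (sqrt 5 * INR (fib n) = alpha ^ n - (1 - alpha) ^ n
   /\ INR (lucas n) = alpha ^ n + (1 - alpha) ^ n)
  /\ (sqrt 5 * INR (fib (S n)) = alpha ^ S n - (1 - alpha) ^ S n
   /\ INR (lucas (S n)) = alpha ^ S n + (1 - alpha) ^ S n).
Proof.
pose proof alpha_sqr as Ha.
induction n as [|n [[F0 L0] [F1 L1]]].
- simpl; unfold alpha; lra.
- split; [easy|].
  change (fib (S (S n))) with (fib (S n) + fib n)%nat.
  change (lucas (S (S n))) with (lucas (S n) + lucas n)%nat.
  rewrite !plus_INR, Rmult_plus_distr_l, F0, F1, L0, L1.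
  replace (alpha ^ S (S n)) with (alpha ^ n * alpha ^ 2) by (simpl; ring).
  replace ((1 - alpha) ^ S (S n)) with ((1 - alpha) ^ n * (1 - 2 * alpha + alpha ^ 2))
    by (simpl; ring).
  rewrite Ha; simpl; split; ring.
Qed.

Lemma fib_lucas_even (n : nat) :
  sqrt 5 * INR (fib (2 * n)) = alpha ^ (2 * n) - / alpha ^ (2 * n)
  /\ INR (lucas (2 * n)) = alpha ^ (2 * n) + / alpha ^ (2 * n).
Proof.
pose proof alpha_gt1.
replace (/ alpha ^ (2 * n)) with ((1 - alpha) ^ (2 * n)).
- exact (proj1 (fib_lucas_binet (2 * n))).
- rewrite <- pow_inv, !pow_mult; f_equal.
  pose proof alpha_sqr.
  (* [alpha^2 = alpha + 1] says [alpha * (1 - alpha) = -1]; the even exponent then removes the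
     sign. *)
  replace (1 - alpha) with (- / alpha); [ring|].
  apply (Rmult_eq_reg_r alpha); [|lra].
  replace (- / alpha * alpha) with (-1) by (field; lra); lra.
Qed.

Theorem corollary22 (r : nat) (hr : (0 < r)%nat) :
  is_RInt
    (fun x : R => x * sin x ^ 3 /
       (4 + 5 * INR (fib (2 * r)) ^ 2 * sin x ^ 2) ^ 2)
    0 PI
    (- (1 / 10) * (PI / INR (fib (4 * r)) ^ 2)
     + 2 * PI * sqrt 5 / 25 * (INR (lucas (4 * r)) / INR (fib (4 * r)) ^ 3)
       * INR r * ln alpha).
Proof.
pose proof alpha_gt1 as Ha.
pose proof (sqrt_lt_R0 5 ltac:(lra)) as Hs.
pose proof (sqrt_sqrt 5 ltac:(lra)) as Hss.
destruct (fib_lucas_even r) as [F2 _].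
destruct (fib_lucas_even (2 * r)) as [F4 L4].
replace (2 * (2 * r))%nat with (4 * r)%nat in F4, L4 by lia.
replace (alpha ^ (4 * r)) with ((alpha ^ (2 * r)) ^ 2) in F4, L4
  by (rewrite <- pow_mult; f_equal; lia).
assert (Hln : ln (alpha ^ (2 * r)) = 2 * INR r * ln alpha).
{ rewrite ln_pow, mult_INR by lra; simpl; ring. }
assert (Ha1 : 1 < alpha ^ (2 * r)) by (apply Rlt_pow_R1; [lra | lia]).
set (a := alpha ^ (2 * r)) in *.
assert (Hia : 0 < / a) by (apply Rinv_0_lt_compat; lra).
assert (Hai : a * / a = 1) by (field; lra).
assert (Hia1 : / a < 1) by nra.
set (f := INR (fib (2 * r))) in *.
assert (H5 : 5 * f ^ 2 = (a - / a) ^ 2) by (rewrite <- F2; ring [Hss]).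
(* For [p = a + / a] and [q = a - / a], [p^2 - q^2 = 4 * (a * / a) = 4]. *)
pose proof (is_RInt_sin3_over_square (a + / a) (a - / a)
  ltac:(lra) ltac:(lra) ltac:(nra)) as HI.
apply (is_RInt_id_mul_sin (fun y => y ^ 3 / (4 + (a - / a) ^ 2 * y ^ 2) ^ 2)) in HI.
2:{ intros y; apply (ex_derive_continuous (K := R_AbsRing) (V := R_NormedModule)).
  auto_derive. assert (0 <= (a - / a) ^ 2 * y ^ 2) by nra. nra. }
(* This is [F_{4r} = L_{2r} F_{2r}], read off from [a^2 - / a^2 = (a + / a) * (a - / a)]. *)
assert (HF : INR (fib (4 * r)) = (a + / a) * (a - / a) / sqrt 5).
{ apply (Rmult_eq_reg_l (sqrt 5)); [|lra].
  rewrite F4; field; lra. }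
assert (Hlog : ln (a + / a + (a - / a)) - ln (a + / a - (a - / a))
  = 4 * INR r * ln alpha).
{ replace (a + / a + (a - / a)) with (2 * a) by ring.
  replace (a + / a - (a - / a)) with (2 * / a) by ring.
  rewrite !ln_mult, ln_Rinv, Hln by lra; ring. }
rewrite Hlog in HI.
match goal with |- is_RInt _ _ _ ?v => match type of HI with is_RInt _ _ _ ?w =>
  replace v with w end end.
- refine (is_RInt_ext _ _ _ _ _ _ HI); intros x _.
  rewrite H5; unfold Rdiv; symmetry; apply Rmult_assoc.
- replace (INR (lucas (4 * r))) with (((a + / a) ^ 2 + (a - / a) ^ 2) / 2).
  2:{ rewrite L4; field; lra. }
  rewrite HF.
  assert (Hp : 0 < a + / a) by lra.
  assert (Hq : 0 < a - / a) by lra.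
  set (p := a + / a) in *; set (q := a - / a) in *.
  (* [field] treats [sqrt 5] as an atom, so its powers are spelled out as products that [Hss] can
     turn into 5. *)
  replace (((p * q) / sqrt 5) ^ 2) with ((p * q) ^ 2 / (sqrt 5 * sqrt 5))
    by (field; lra).
  replace (((p * q) / sqrt 5) ^ 3) with ((p * q) ^ 3 / (sqrt 5 * sqrt 5 * sqrt 5))
    by (field; lra).
  rewrite !Hss.
  transitivity (- (PI / (2 * (p * q) ^ 2))
    + PI * (p ^ 2 + q ^ 2) / (p * q) ^ 3 * INR r * ln alpha).
  + field; lra.
  + replace (2 * PI * sqrt 5 / 25 * ((p ^ 2 + q ^ 2) / 2 / ((p * q) ^ 3 / (5 * sqrt 5))))
      with (PI * (sqrt 5 * sqrt 5) / 5 * (p ^ 2 + q ^ 2) / (p * q) ^ 3)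
      by (field; lra).
    rewrite Hss; field; lra.
Qed.
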